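(* Let $m,n\in\mathbb{N}\setminus\{1\}$ and let $C_{m,n}$ be the tree with $m+n+2$ vertices and diameter $3$ (so that $m,n\ge 2$) consisting of two adjacent vertices $1$ and $2$, together with $m$ leaves attached to vertex $1$ and $n$ leaves attached to vertex $2$. Let $\mathcal{A}(C_{m,n})$ and $\mathcal{A}_{RW}(C_{m,n})$ be the evolution algebras associated to $C_{m,n}$ and to the symmetric random walk on $C_{m,n}$, respectively. Then $\mathcal{A}(C_{m,n})\ncong \mathcal{A}_{RW}(C_{m,n})$. Moreover, the only homomorphism between $\mathcal{A}(C_{m,n})$ and $\mathcal{A}_{RW}(C_{m,n})$ is the null map.
   Context: Algebras are over a field $\mathbb{K}$. Let $G=(V,E)$ be a finite simple connected graph with adjacency matrix $A=(a_{ij})_{i,j\in V}$; let $\deg(i)=\sum_{k}a_{ik}$. The evolution algebra $\mathcal{A}(G)$ associated to $G$ is the algebra with basis $\{e_i\}_{i\in V}$ and bilinear product determined by $e_i\cdot e_i=\sum_{k\in V}a_{ik}e_k$ and $e_i\cdot e_j=0$ for $i\ne j$. The evolution algebra $\mathcal{A}_{RW}(G)$ associated to the symmetric random walk on $G$ is the algebra with basis $\{e_i\}_{i\in V}$ and bilinear product determined by $e_i\cdot e_i=\sum_{k\in V}\frac{a_{ik}}{\deg(i)}e_k$ and $e_i\cdot e_j=0$ for $i\neq j$. An algebra homomorphism is a $\mathbb{K}$-linear map $f$ with $f(xy)=f(x)f(y)$ for all $x,y$; an isomorphism (written $\cong$) is a bijective homomorphism. The null map is the map sending everything to $0$.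
   Formalization: Degrees are assumed nonzero in K; non-isomorphism is proved when m and n are nonzero in K, and the null-map claim (both directions) when sums of m and of n squares over K vanish only trivially (e.g. K real); without such conditions the claims fail, e.g. the null-map claim over C. *)

(* Defs.v *)
From HB Require Import structures.
From mathcomp Require Import all_boot all_order all_algebra.
Set Implicit Arguments.
Unset Strict Implicit.
Unset Printing Implicit Defensive.
Import GRing.Theory.
Local Open Scope ring_scope.

(* Algebras are not assumed associative, commutative or unital, so the ring
   hierarchy does not apply: the product is just a bilinear map. *)
Record algebra (K : fieldType) := Algebra {
  acarrier :> lmodType K;
  amul : {bilinear acarrier -> acarrier -> acarrier}
}.

Definition is_algebra_hom (K : fieldType) (A B : algebra K)
    (f : {linear A -> B}) : Prop :=
  forall x y : A, f (amul A x y) = amul B (f x) (f y).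

Definition algebra_isomorphic (K : fieldType) (A B : algebra K) : Prop :=
  exists f : {linear A -> B}, is_algebra_hom f /\ bijective f.

Section EvolutionAlgebra.
Variables (K : fieldType) (V : finType) (w : V -> V -> K).

(* K^o is K as a module over itself, so that K^V is an lmodType K. *)
Definition evol_space : lmodType K := {ffun V -> K^o}.

Definition evol_basis (i : V) : evol_space := [ffun k => (k == i)%:R].

(* x = \sum_i x i *: evol_basis i, so this is the bilinear product with
   e_i e_i = \sum_k w i k *: e_k and e_i e_j = 0 for i != j. *)
Definition evol_mul (x y : evol_space) : evol_space :=
  \sum_i (x i * y i) *: \sum_k w i k *: evol_basis k.

Lemma evol_mul_linearl (y : evol_space) : linear (evol_mul ^~ y).
Proof.
move=> a x z; rewrite /evol_mul scaler_sumr -big_split /=.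
apply: eq_bigr => i _; rewrite !ffunE scalerA -scalerDl; congr (_ *: _).
by rewrite mulrDl mulrA.
Qed.

Lemma evol_mul_linearr (x : evol_space) : linear (evol_mul x).
Proof.
move=> a y z; rewrite /evol_mul scaler_sumr -big_split /=.
apply: eq_bigr => i _; rewrite !ffunE scalerA -scalerDl; congr (_ *: _).
by rewrite mulrDr mulrCA.
Qed.

HB.instance Definition _ :=
  bilinear_isBilinear.Build K evol_space evol_space evol_space
    *:%R *:%R evol_mul (conj evol_mul_linearl evol_mul_linearr).

Definition evol_algebra : algebra K :=
  @Algebra K evol_space evol_mul.

Lemma evol_expand (x : evol_space) : x = \sum_i x i *: evol_basis i.
Proof.
apply/ffunP => k; rewrite sum_ffunE (bigD1 k) //= !ffunE eqxx big1 ?addr0.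
  by rewrite [_ *: _]mulr1.
by move=> i /negPf ik; rewrite !ffunE eq_sym ik scaler0.
Qed.

Lemma evol_mul_basis (i j : V) :
  amul evol_algebra (evol_basis i) (evol_basis j) =
  if i == j then \sum_k w i k *: evol_basis k else 0.
Proof.
rewrite /= /evol_mul (bigD1 i) //= !ffunE eqxx mul1r [X in _ + X]big1 ?addr0.
  by case: (i == j) => /=; rewrite ?mulr1n ?mulr0n ?scale1r ?scale0r.
by move=> k /negPf ki; rewrite !ffunE ki mul0r scale0r.
Qed.

End EvolutionAlgebra.

Record cgraph := CGraph {
  vertex :> finType;
  adj : rel vertex;
  adj_sym : symmetric adj;
  adj_irr : irreflexive adj;
  adj_conn : forall u v : vertex, connect adj u v
}.

Definition deg (G : cgraph) (i : G) : nat := (\sum_(k : G) adj i k)%N.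

Definition graph_algebra (K : fieldType) (G : cgraph) : algebra K :=
  evol_algebra (fun i k : G => (adj i k)%:R : K).

(* Meaningful only if every (deg i)%:R is nonzero in K: by convention the
   inverse of 0 is 0. *)
Definition rw_algebra (K : fieldType) (G : cgraph) : algebra K :=
  evol_algebra (fun i k : G => (adj i k)%:R / (deg i)%:R : K).

Section Caterpillar.
Variables m n : nat.

(* inl true and inl false are the vertices 1 and 2; inr (inl _) are the m
   leaves at vertex 1 and inr (inr _) the n leaves at vertex 2. *)
Definition cat_vertex : finType := (bool + ('I_m + 'I_n))%type.

Definition cat_adj : rel cat_vertex := fun u v =>
  match u, v with
  | inl a, inl b => a != b
  | inl a, inr (inl _) | inr (inl _), inl a => a
  | inl a, inr (inr _) | inr (inr _), inl a => ~~ a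
  | inr _, inr _ => false
  end.

Lemma cat_adj_sym : symmetric cat_adj.
Proof. by move=> [[]|[i|i]] [[]|[j|j]]. Qed.

Lemma cat_adj_irr : irreflexive cat_adj.
Proof. by move=> [[]|[i|i]]. Qed.

Lemma cat_adj_conn (u v : cat_vertex) : connect cat_adj u v.
Proof.
have to1 x : connect cat_adj x (inl true).
  have c2 : connect cat_adj (inl false) (inl true) by apply: connect1.
  case: x => [[]|[i|i]] //; first exact: connect1.
  by apply: connect_trans c2; apply: connect1.
by apply: (connect_trans (to1 u)); rewrite (sym_connect_sym cat_adj_sym) to1.
Qed.

Definition caterpillar : cgraph :=
  CGraph cat_adj_sym cat_adj_irr cat_adj_conn.

End Caterpillar.

(* The quadratic form x_1^2 + ... + x_d^2 is anisotropic over K; this holds for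
   all d exactly when K is formally real.  If it fails for d = m, say at x, then
   sending a leaf l at vertex 1 to \sum_k x_k e_k (k ranging over those leaves),
   another such leaf l' to the opposite, and all other e_i to 0, is a nonzero
   homomorphism between the two algebras of caterpillar m n, in either
   direction. *)
Definition sum_squares_anisotropic (K : fieldType) (d : nat) : Prop :=
  forall x : 'I_d -> K, \sum_i x i ^+ 2 = 0 -> forall i, x i = 0.

(* Main.v *)
Require Import Defs.
From mathcomp Require Import all_boot all_order all_algebra.
Import GRing.Theory.
Local Open Scope ring_scope.

(* Both algebras have product e_u e_u = c_u * sum of the neighbours of u, with
   c_u = 1 at leaves; let c, c' be the values at the two centres in the source
   and the target of a homomorphism f.  Two leaves at the same centre have equal
   squares and zero product, so their images have no component at the centres,
   and f e_1, f e_2 lie in the span of the centres.  Let P a b be the coordinate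
   of f e_a at the centre b.  Comparing f (e_a e_a) with (f e_a)^2, and norms of
   the sum over the leaves at a, a nonzero P a b forces
     c' (~b) P(~a)(~b)^2 = c (~a) P a b  and  N_a P a b = N_b P(~a)(~b)^2,
   where N is the number of leaves; since the leaf images are orthogonal of norm
   P a b, also N_a = N_b.  Hence c' (~b) = c (~a), which is impossible when one
   algebra has c = 1 and the other c = 1 / (N + 1).  So P = 0, f kills the
   centres, and the images of the leaves are isotropic. *)

(* Without the cast, coordinates would be multiplied in K^o rather than in K. *)
Definition coord {K : fieldType} {V : finType} (i : V) (x : evol_space K V) : K := x i.

(** * Coordinates in an evolution algebra *)

Section Coordinates.
Variables (K : fieldType) (V : finType) (i : V).
Implicit Types x y : evol_space K V.

Lemma coord_inj x y : (forall j, coord j x = coord j y) -> x = y.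
Proof. by move=> xy; apply/ffunP => j; exact: xy. Qed.

Lemma coord0 : coord i (0 : evol_space K V) = 0.
Proof. by rewrite /coord ffunE. Qed.

Lemma coordD x y : coord i (x + y) = coord i x + coord i y.
Proof. by rewrite /coord ffunE. Qed.

Lemma coordZ a x : coord i (a *: x) = a * coord i x.
Proof. by rewrite /coord ffunE. Qed.

Lemma coord_sum (I : finType) (Q : pred I) (F : I -> evol_space K V) :
  coord i (\sum_(j | Q j) F j) = \sum_(j | Q j) coord i (F j).
Proof. exact: (big_morph _ coordD coord0). Qed.

Lemma coord_basis j : coord i (evol_basis K j) = (i == j)%:R.
Proof. by rewrite /coord ffunE. Qed.

Lemma coord_mul (w : V -> V -> K) x y :
  coord i (amul (evol_algebra w) x y) = \sum_j coord j x * coord j y * w j i.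
Proof.
rewrite /= /evol_mul coord_sum; apply: eq_bigr => j _.
rewrite coordZ coord_sum (bigD1 i) //= coordZ coord_basis eqxx mulr1 big1 ?addr0 //.
by move=> k /negPf ki; rewrite coordZ coord_basis eq_sym ki mulr0.
Qed.

End Coordinates.

(** * Leaves, adjacency and degrees in the caterpillar *)

Section Caterpillar.
Variables m n : nat.

Definition side (l : 'I_m + 'I_n) : bool := if l is inl _ then true else false.

Definition leaf_count (b : bool) : nat := #|[pred l | side l == b]|.

Lemma leaf_countE b : leaf_count b = if b then m else n.
Proof.
rewrite /leaf_count -sum1_card big_sumType /=.
by case: b => /=; [rewrite [X in (_ + X)%N]big_pred0 // addn0
                  | rewrite [X in (X + _)%N]big_pred0 // add0n];
   rewrite sum1_card; rewrite -[RHS]card_ord; apply: eq_card.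
Qed.

Lemma cat_adj_center_leaf b l : cat_adj (inl b) (inr l) = (side l == b).
Proof. by case: b l => [] []. Qed.

Lemma cat_adj_leaf_center b l : cat_adj (inr l) (inl b) = (side l == b).
Proof. by case: b l => [] []. Qed.

Lemma cat_adj_centers b : cat_adj (inl (~~ b) : cat_vertex m n) (inl b).
Proof. by case: b. Qed.

Lemma cat_adj_leaves k l : cat_adj (inr k : cat_vertex m n) (inr l) = false.
Proof. by case: k. Qed.

Lemma neq_negb b : (b == ~~ b) = false.
Proof. by case: b. Qed.

Lemma big_center (R : nmodType) (F : bool -> R) b : \sum_a F a = F b + F (~~ b).
Proof. by rewrite big_bool; case: b; rewrite // addrC. Qed.

(** The successor accounts for the other centre. *)
Lemma deg_center b : deg (inl b : caterpillar m n) = (leaf_count b).+1.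
Proof.
rewrite /deg big_sumType /= big_bool addnC.
have -> : (\sum_l cat_adj (inl b) (inr l : cat_vertex m n) = leaf_count b)%N.
  under eq_bigr do rewrite cat_adj_center_leaf.
  by rewrite -big_mkcond sum1_card.
by case: b; rewrite ?addn0 ?add0n addn1.
Qed.

Lemma deg_leaf l : deg (inr l : caterpillar m n) = 1%N.
Proof.
rewrite /deg big_sumType /= [X in (_ + X)%N]big1 ?big_bool; last by case: l.
by case: l.
Qed.

(** * Products in caterpillar algebras with weighted centres *)

Section Weights.
Variable K : fieldType.

Definition cat_weight (c : bool -> K) (w : cat_vertex m n -> cat_vertex m n -> K) :=
  forall u v, w u v = (if u is inl b then c b else 1) * (cat_adj u v)%:R.

(** What the leaves at [b] contribute to the coordinate at [b] of a product. *)
Definition leaf_dot (b : bool) (x y : evol_space K (cat_vertex m n)) : K :=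
  \sum_(l | side l == b) coord (inr l) x * coord (inr l) y.

Lemma leaf_dot0P (x : evol_space K (cat_vertex m n)) :
  sum_squares_anisotropic K m -> sum_squares_anisotropic K n ->
  (forall b, leaf_dot b x x = 0) -> forall l, coord (inr l) x = 0.
Proof.
move=> Am An x0 [i|i].
  apply: (Am (fun i => coord (inr (inl i)) x)); rewrite -[RHS](x0 true) /leaf_dot.
  by rewrite big_sumType /= [X in _ + X]big_pred0 // addr0.
apply: (An (fun i => coord (inr (inr i)) x)); rewrite -[RHS](x0 false) /leaf_dot.
by rewrite big_sumType /= [X in X + _]big_pred0 // add0r.
Qed.

Lemma cat_mul_center {c w} (x y : evol_algebra w) b : cat_weight c w ->
  coord (inl b) (amul (evol_algebra w) x y) =
  c (~~ b) * (coord (inl (~~ b)) x * coord (inl (~~ b)) y)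
  + leaf_dot b x y.
Proof.
move=> cw; rewrite coord_mul big_sumType /=; congr (_ + _).
  rewrite (big_center _ _ b) !cw cat_adj_irr cat_adj_centers mulr0n !mulr0.
  by rewrite add0r mulr1 mulrC.
rewrite [RHS]big_mkcond; apply: eq_bigr => l _.
by rewrite cw cat_adj_leaf_center mul1r; case: eqP; rewrite ?mulr1 ?mulr0.
Qed.

Lemma cat_mul_leaf {c w} (x y : evol_algebra w) l : cat_weight c w ->
  coord (inr l) (amul (evol_algebra w) x y) =
  c (side l) * (coord (inl (side l)) x * coord (inl (side l)) y).
Proof.
move=> cw; rewrite coord_mul big_sumType /= [X in _ + X]big1 ?addr0; last first.
  by move=> k _; rewrite cw cat_adj_leaves mulr0n !mulr0.
rewrite (big_center _ _ (side l)) !cw !cat_adj_center_leaf eqxx neq_negb.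
by rewrite mulr0n !mulr0 addr0 mulr1 mulrC.
Qed.

(** * Relations satisfied by a homomorphism *)

Section Hom.
Variables (c c' : bool -> K) (w w' : cat_vertex m n -> cat_vertex m n -> K).
Hypotheses (cw : cat_weight c w) (cw' : cat_weight c' w').
Hypotheses (c_neq0 : forall b, c b != 0) (c'_neq0 : forall b, c' b != 0).
Hypothesis leaf_count_gt1 : forall b, (1 < leaf_count b)%N.
Variable f : {linear evol_algebra w -> evol_algebra w'}.
Hypothesis f_hom : is_algebra_hom f.

Let X (v : cat_vertex m n) : evol_space K (cat_vertex m n) := f (evol_basis K v).
Let P (a b : bool) : K := coord (inl b) (X (inl a)).

Let X_orth u v : u != v -> amul (evol_algebra w') (X u) (X v) = 0.
Proof.
by move=> /negPf uv; rewrite /X -f_hom evol_mul_basis uv linear0.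
Qed.

Let X_leaf_sq l : amul (evol_algebra w') (X (inr l)) (X (inr l)) = X (inl (side l)).
Proof.
rewrite /X -f_hom evol_mul_basis eqxx big_sumType /= [X in _ + X]big1 ?addr0.
  rewrite (big_center _ _ (side l)) !cw !cat_adj_leaf_center eqxx neq_negb.
  by rewrite mulr0n mulr0 scale0r addr0 mulr1 scale1r.
by move=> k _; rewrite cw cat_adj_leaves mulr0n mulr0 scale0r.
Qed.

Let X_center_sq a : amul (evol_algebra w') (X (inl a)) (X (inl a)) =
  c a *: (X (inl (~~ a)) + \sum_(l | side l == a) X (inr l)).
Proof.
rewrite /X -f_hom evol_mul_basis eqxx big_sumType /=.
rewrite -linear_sum -linearD -linearZ; congr (f _); rewrite scalerDr; congr (_ + _).
  rewrite (big_center _ _ a) !cw cat_adj_irr mulr0n mulr0 scale0r.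
  by rewrite add0r -cat_adj_sym cat_adj_centers mulr1.
rewrite scaler_sumr [RHS]big_mkcond; apply: eq_bigr => l _.
by rewrite cw cat_adj_center_leaf; case: eqP; rewrite ?mulr1 // mulr0 scale0r.
Qed.

Let exists_leaf b : exists l, side l = b.
Proof.
have /card_gt0P[l] : (0 < leaf_count b)%N by exact: ltnW.
by rewrite inE => /eqP; exists l.
Qed.

(* Two leaves at the same centre have equal squares and zero product. *)
Let X_leaf_center l b : coord (inl b) (X (inr l)) = 0.
Proof.
have [k kb] := exists_leaf b.
have [l' /eqP sl' ll'] : exists2 l', side l' == side l & l' != l.
  have := leaf_count_gt1 (side l); rewrite /leaf_count (cardD1 l) inE eqxx.
  by rewrite ltnS => /card_gt0P[l']; rewrite !inE => /andP[]; exists l'.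
(* The only neighbour of [k] is [b], so this coordinate of a product is [c' b] times the product of
   the coordinates at [b]. *)
have /(congr1 (coord (inr k))) := X_leaf_sq l; rewrite -sl' -X_leaf_sq.
rewrite !(cat_mul_leaf _ _ _ cw') kb => /(mulfI (c'_neq0 b)) sq.
have /(congr1 (coord (inr k))) : amul (evol_algebra w') (X (inr l')) (X (inr l)) = 0.
  by apply: X_orth.
rewrite (cat_mul_leaf _ _ _ cw') kb coord0 => /eqP.
rewrite !mulf_eq0 (negPf (c'_neq0 b)) orFb => /orP[/eqP z|/eqP//].
by move/eqP: sq; rewrite z mul0r mulf_eq0 orbb => /eqP.
Qed.

(** The image of a centre is the square of a leaf image, and leaf coordinates of a square involve
    only centre coordinates, which vanish for leaf images. *)
Let X_center_leaf a k : coord (inr k) (X (inl a)) = 0.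
Proof.
have [l <-] := exists_leaf a.
by rewrite -X_leaf_sq (cat_mul_leaf _ _ _ cw') X_leaf_center mul0r mulr0.
Qed.

Let leaf_dot_sq l b : leaf_dot b (X (inr l)) (X (inr l)) = P (side l) b.
Proof.
by rewrite /P -X_leaf_sq (cat_mul_center _ _ _ cw') X_leaf_center mul0r mulr0 add0r.
Qed.

Let leaf_dot_orth l l' b : l != l' -> leaf_dot b (X (inr l)) (X (inr l')) = 0.
Proof.
move=> ll'; have /(congr1 (coord (inl b))) := @X_orth (inr l) (inr l') ll'.
by rewrite (cat_mul_center _ _ _ cw') X_leaf_center mul0r mulr0 add0r coord0.
Qed.

(** Read [X_center_sq] at the centre [~~ b]: the leaf terms vanish on both sides. *)
Let P_sq a b : c' b * P a b ^+ 2 = c a * P (~~ a) (~~ b).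
Proof.
have /(congr1 (coord (inl (~~ b)))) := X_center_sq a.
rewrite (cat_mul_center _ _ _ cw') negbK coordZ coordD coord_sum.
by rewrite /leaf_dot !big1 ?addr0 // => l _; rewrite ?X_leaf_center ?X_center_leaf ?mul0r.
Qed.

Let P_orth a b : P a b * P (~~ a) b = 0.
Proof.
have [k kb] := exists_leaf b.
have /(congr1 (coord (inr k))) := @X_orth (inl a) (inl (~~ a)) (ltac:(by case: a)).
rewrite (cat_mul_leaf _ _ _ cw') kb coord0 => /eqP.
by rewrite mulf_eq0 (negPf (c'_neq0 b)) => /eqP.
Qed.

(** Read [X_center_sq] at the leaf [k]; [P_sq] turns the left side into a multiple of [c a], which
    cancels. *)
Let sum_leaf a k :
  \sum_(l | side l == a) coord (inr k) (X (inr l)) = P (~~ a) (~~ side k).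
Proof.
have /(congr1 (coord (inr k))) := X_center_sq a.
rewrite (cat_mul_leaf _ _ _ cw') -expr2 P_sq coordZ => /(mulfI (c_neq0 a)) ->.
by rewrite coordD X_center_leaf add0r coord_sum.
Qed.

(** Both sides are the norm at [b] of the sum of the leaf images at [a]: once by orthogonality, once
    coordinatewise by [sum_leaf]. *)
Let P_count a b :
  (leaf_count a)%:R * P a b = (leaf_count b)%:R * P (~~ a) (~~ b) ^+ 2.
Proof.
transitivity (leaf_dot b (\sum_(l | side l == a) X (inr l))
                         (\sum_(l | side l == a) X (inr l))).
  rewrite /leaf_dot.
  under eq_bigr do rewrite !coord_sum big_distrlr /=.
  rewrite exchange_big /=.
  transitivity (\sum_(l | side l == a) P a b).
    by rewrite sumr_const mulr_natl.
  apply: eq_bigr => l la; rewrite exchange_big /= (bigD1 l la) /=.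
  rewrite [X in _ + X]big1.
    by rewrite addr0 -(eqP la) -leaf_dot_sq.
  by move=> l' /andP[_ ll']; apply: leaf_dot_orth; rewrite eq_sym.
rewrite /leaf_dot (eq_bigr (fun=> P (~~ a) (~~ b) ^+ 2)).
  by rewrite sumr_const mulr_natl.
by move=> k /eqP kb; rewrite coord_sum sum_leaf kb.
Qed.

(* Pairwise orthogonal vectors of equal nonzero norm are linearly independent. *)
Let leaf_count_le a b : P a b != 0 -> (leaf_count a <= leaf_count b)%N.
Proof.
move=> Pn0.
pose W := \matrix_(i < leaf_count a, j < leaf_count b)
  coord (inr (enum_val j)) (X (inr (enum_val i))).
(* Since [W *m W^T] is [P a b] times the identity, [W] has a right inverse, hence no more rows than
   columns. *)
apply: (@mulmx1_min _ _ _ W ((P a b)^-1 *: W^T)).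
rewrite -scalemxAr; apply/matrixP => i j; rewrite !mxE.
under eq_bigr do rewrite !mxE.
rewrite -(big_enum_val (A := [pred l | side l == b]) (fun k => coord (inr k) (X (inr (enum_val i)))
                                 * coord (inr k) (X (inr (enum_val j))))) /=.
rewrite -[\sum_(_ in _) _]/(leaf_dot b _ _).
have [<-|ij] := eqVneq i j.
  rewrite leaf_dot_sq; have := enum_valP i; rewrite inE => /eqP ->.
  by rewrite mulVf.
by rewrite leaf_dot_orth ?mulr0 // (inj_eq enum_val_inj).
Qed.

(** * Vanishing on the centres and its consequences *)

Hypothesis leaf_count_neq0 : forall b, (leaf_count b)%:R != 0 :> K.
Hypothesis c_neq : forall a b, c a != c' b.

Lemma hom_center0 a : f (evol_basis K (inl a)) = 0.
Proof.
suff P0 b : P a b = 0.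
  by apply: coord_inj => -[b|k]; rewrite coord0; [exact: P0 | exact: X_center_leaf].
apply/eqP; apply: contraT => Pn0.
have Pn0' : P (~~ a) (~~ b) != 0.
  apply: contra_neq Pn0 => P0; have /eqP := P_sq a b.
  by rewrite P0 mulr0 mulf_eq0 (negPf (c'_neq0 b)) expf_eq0 => /eqP.
have ab : leaf_count a = leaf_count b.
  have [->//|nab] := eqVneq a b.
  apply/eqP; rewrite eqn_leq leaf_count_le //=.
  (* Here [~~ a = b] and [~~ b = a], so the opposite entry gives the reverse inequality. *)
  have := leaf_count_le _ _ Pn0'.
  by case: a b nab {Pn0 Pn0'} => [] [].
have := P_count a b; rewrite ab => /(mulfI (leaf_count_neq0 b)) PE.
(* By [PE] the square in [P_sq] is [P a b] itself; cancelling it leaves [c' (~~ b) = c (~~ a)]. *)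
have := P_sq (~~ a) (~~ b); rewrite -PE !negbK => /(mulIf Pn0)/eqP.
by rewrite eq_sym (negPf (c_neq _ _)).
Qed.

Lemma not_injective_hom : ~ injective f.
Proof.
move=> /(_ (evol_basis K (inl true)) 0); rewrite hom_center0 linear0.
move=> /(_ erefl)/(congr1 (coord (inl true))); rewrite coord_basis coord0 eqxx => /eqP.
by rewrite oner_eq0.
Qed.

Lemma hom_null :
  sum_squares_anisotropic K m -> sum_squares_anisotropic K n ->
  forall x, f x = 0.
Proof.
move=> Am An x; rewrite [x](evol_expand x) linear_sum big1 // => -[a|l] _.
  by rewrite linearZ hom_center0 [LHS]scaler0.
rewrite linearZ; suff -> : f (evol_basis K (inr l)) = 0 by rewrite [LHS]scaler0.
apply: coord_inj => -[b|k]; rewrite coord0; first exact: X_leaf_center.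
(* The norms of a leaf image are centre coordinates of the image of its centre, already known to be
   0. *)
apply: (leaf_dot0P (X (inr l))) => // b.
by rewrite leaf_dot_sq /P /X hom_center0 coord0.
Qed.

End Hom.

(** * The two algebras as weighted caterpillar algebras *)

Lemma graph_cat_weight :
  cat_weight (fun=> 1) (fun u v : caterpillar m n => (adj u v)%:R).
Proof. by move=> [a|l] v; rewrite mul1r. Qed.

Lemma rw_cat_weight :
  cat_weight (fun b => (leaf_count b).+1%:R^-1)
    (fun u v : caterpillar m n => (adj u v)%:R / (deg u)%:R).
Proof. by move=> [a|l] v; rewrite mulrC ?deg_center // deg_leaf invr1. Qed.

End Weights.
End Caterpillar.

(** Otherwise the all-ones vector would be isotropic. *)
Lemma anisotropic_natr_neq0 (K : fieldType) (d : nat) :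
  (0 < d)%N -> sum_squares_anisotropic K d -> d%:R != 0 :> K.
Proof.
case: d => // d _ Ad; apply/eqP => d0.
suff /(Ad (fun=> 1))/(_ ord0)/eqP : \sum_(i < d.+1) (1 : K) ^+ 2 = 0.
  by rewrite oner_eq0.
by rewrite sumr_const card_ord expr1n.
Qed.

Theorem proposition3p1 (K : fieldType) (m n : nat)
  (m_gt1 : (1 < m)%N) (n_gt1 : (1 < n)%N)
  (deg_neq0 : forall v : caterpillar m n, (deg v)%:R != 0 :> K) :
  (m%:R != 0 :> K -> n%:R != 0 :> K ->
     ~ algebra_isomorphic (graph_algebra K (caterpillar m n))
                          (rw_algebra K (caterpillar m n)))
  /\
  (sum_squares_anisotropic K m -> sum_squares_anisotropic K n ->
     (forall f : {linear graph_algebra K (caterpillar m n) ->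
                         rw_algebra K (caterpillar m n)},
        is_algebra_hom f -> forall x, f x = 0)
     /\
     (forall g : {linear rw_algebra K (caterpillar m n) ->
                         graph_algebra K (caterpillar m n)},
        is_algebra_hom g -> forall x, g x = 0)).
Proof.
pose r b : K := (leaf_count m n b).+1%:R^-1.
have one_n0 (b : bool) : (1 : K) != 0 by exact: oner_neq0.
have r_n0 b : r b != 0 by rewrite invr_eq0 -deg_center.
have gt1 b : (1 < leaf_count m n b)%N by rewrite leaf_countE; case: b.
have count_n0 : m%:R != 0 :> K -> n%:R != 0 :> K ->
    forall b, (leaf_count m n b)%:R != 0 :> K.
  by move=> m0 n0 b; rewrite leaf_countE; case: b.
(* [1 / (N + 1) = 1] would force [N = 0] in [K]. *)
have r_n1 : m%:R != 0 :> K -> n%:R != 0 :> K -> forall b, r b != 1.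
  move=> m0 n0 b; rewrite invr_eq1 -addn1 natrD -subr_eq0 addrK.
  exact: count_n0.
split=> [m0 n0 [f [f_hom /bij_inj]]|Am An].
  apply: (not_injective_hom _ _ _ _ _ _ _ (graph_cat_weight m n K)
            (rw_cat_weight m n K)) => //.
  - exact: count_n0.
  - by move=> a b; rewrite eq_sym r_n1.
have m0 := anisotropic_natr_neq0 _ _ (ltnW m_gt1) Am.
have n0 := anisotropic_natr_neq0 _ _ (ltnW n_gt1) An.
split=> f f_hom.
  apply: (hom_null _ _ _ _ _ _ _ (graph_cat_weight m n K)
            (rw_cat_weight m n K)) => //.
  - exact: count_n0.
  - by move=> a b; rewrite eq_sym r_n1.
(* The reverse direction exchanges the weights of source and target. *)
apply: (hom_null _ _ _ _ _ _ _ (rw_cat_weight m n K)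
          (graph_cat_weight m n K)) => //.
- exact: count_n0.
- by move=> a b; rewrite r_n1.
Qed.
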